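(* There exists a complete Boolean algebra whose Scott space is well-filtered but neither sober nor co-sober.
   Context: A subset $U$ of a poset $P$ is Scott open if it is an upper set and, whenever a directed (in particular nonempty) set $D\subseteq P$ has a supremum with $\bigvee D\in U$, one has $D\cap U\neq\varnothing$; the Scott space $\Sigma P$ is $P$ with the topology of Scott open sets. Its specialization order is the original order of $P$. Compactness means that every open cover has a finite subcover (no separation axiom is assumed). A subset of a $T_0$-space is saturated if it is an intersection of open sets (equivalently, an upper set in the specialization order, where $x\leq y$ iff $x\in\operatorname{cl}\{y\}$). For a $T_0$-space $X$, let $\mathcal{Q}(X)$ be the family of nonempty compact saturated subsets of $X$. $X$ is well-filtered if for every filtered family $\mathcal{K}\subseteq\mathcal{Q}(X)$ (nonempty, and any two members of $\mathcal{K}$ contain a common member of $\mathcal{K}$) and every open set $U$, $\bigcap\mathcal{K}\subseteq U$ implies $K\subseteq U$ for some $K\in\mathcal{K}$. $X$ is sober if for every irreducible closed set $A$ there is a unique point $x\in X$ with $A=\operatorname{cl}\{x\}$; here a nonempty set $A$ is irreducible if $A\subseteq F_1\cup F_2$ with $F_1,F_2$ closed implies $A\subseteq F_1$ or $A\subseteq F_2$. An element $K\in\mathcal{Q}(X)$ is $k$-irreducible if $K=K_1\cup K_2$ with $K_1,K_2\in\mathcal{Q}(X)$ implies $K=K_1$ or $K=K_2$. $X$ is co-sober if every $k$-irreducible $K\in\mathcal{Q}(X)$ has the form ${\uparrow}x=\{y\in X:x\leq y\}$ (specialization order) for some point $x\in X$. *)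

(* Defs.v *)
From HB Require Import structures.
From mathcomp Require Import all_boot all_order all_classical.
From mathcomp Require Import topology_structure compact.

Set Implicit Arguments.
Unset Strict Implicit.
Unset Printing Implicit Defensive.

Import Order.TTheory.

Local Open Scope classical_set_scope.
Local Open Scope order_scope.

Section Posets.
Context {d : Order.disp_t} {P : porderType d}.
Implicit Types (D U : set P) (x y z s : P).

Definition upper_set U := forall x y, U x -> x <= y -> U y.

Definition directed D :=
  D !=set0 /\
  forall x y, D x -> D y -> exists z, [/\ D z, x <= z & y <= z].

Definition scott_open U :=
  upper_set U /\
  forall D s, directed D -> supremums D s -> U s -> D `&` U !=set0.

End Posets.

Definition complete_lattice (d : Order.disp_t) (L : latticeType d) :=
  forall A : set L, supremums A !=set0 /\ infimums A !=set0.

(* An alias of P, so that the Scott topology cannot clash with another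
   topology already declared on P. *)
Definition scott (d : Order.disp_t) (P : porderType d) : Type := P.

Section ScottTopology.
Context (d : Order.disp_t) (P : porderType d).

Let scott_openT : scott_open [set: P].
Proof. by split=> // D s [[x Dx] _] _ _; exists x. Qed.

Let scott_openI : setI_closed (@scott_open d P).
Proof.
move=> U V [Uup Uop] [Vup Vop]; split=> [x y [Ux Vx] xy|D s dirD sD [Us Vs]].
  by split; [exact: Uup xy | exact: Vup xy].
have [x [Dx Ux]] := Uop _ _ dirD sD Us.
have [y [Dy Vy]] := Vop _ _ dirD sD Vs.
have [z [Dz xz yz]] := dirD.2 _ _ Dx Dy.
by exists z; split=> //; split; [exact: Uup xz | exact: Vup yz].
Qed.

Let scott_open_bigcup (I : Type) (f : I -> set P) :
  (forall i, scott_open (f i)) -> scott_open (\bigcup_i f i).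
Proof.
move=> fop; split=> [x y [i _ fx] xy|D s dirD sD [i _ fs]].
  by exists i => //; exact: (fop i).1 xy.
have [x [Dx fx]] := (fop i).2 _ _ dirD sD fs.
by exists x; split=> //; exists i.
Qed.

HB.instance Definition _ := Choice.on (scott P).
HB.instance Definition _ :=
  isOpenTopological.Build (scott P) scott_openT scott_openI scott_open_bigcup.

End ScottTopology.

Section Spaces.
Context (X : topologicalType).
Implicit Types (A K : set X) (x y : X).

Definition specialization_le x y := closure [set y] x.

Definition saturated A :=
  exists2 F : set (set X), F `<=` open & A = \bigcap_(U in F) U.

(* The family Q(X). *)
Definition compact_saturated : set (set X) :=
  [set K | [/\ K !=set0, cover_compact K & saturated K]].

Definition filtered (F : set (set X)) :=
  F !=set0 /\
  forall K1 K2, F K1 -> F K2 -> exists2 K, F K & K `<=` K1 `&` K2.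

Definition well_filtered :=
  forall (F : set (set X)) (U : set X),
    F `<=` compact_saturated -> filtered F -> open U ->
    \bigcap_(K in F) K `<=` U -> exists2 K, F K & K `<=` U.

Definition irreducible A :=
  A !=set0 /\
  forall F1 F2 : set X, closed F1 -> closed F2 ->
    A `<=` F1 `|` F2 -> A `<=` F1 \/ A `<=` F2.

Definition sober :=
  forall A, closed A -> irreducible A -> exists! x, A = closure [set x].

Definition k_irreducible K :=
  compact_saturated K /\
  forall K1 K2, compact_saturated K1 -> compact_saturated K2 ->
    K = K1 `|` K2 -> K = K1 \/ K = K2.

Definition co_sober :=
  forall K, k_irreducible K ->
    exists x, K = [set y | specialization_le x y].

End Spaces.

(* Main.v *)
(* The join map of a complete lattice is Scott continuous in each variable, so
   for A Scott closed and K compact the set of the x below some point of A `&` K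
   is Scott closed; Zorn's lemma and compactness then give well-filteredness.

   In a Boolean algebra, complementation sends compact saturated sets to Scott
   closed sets. Hence it suffices to find a map psi from an irreducible T1 space
   X to a complete Boolean algebra B which is continuous for the Scott topology,
   has no largest value, and is such that K, the upper closure of the elements
   ~ psi y, is compact. Indeed the complements of the elements of K then form an
   irreducible closed set without a greatest element, and K is k-irreducible
   without a least element, since a cover of either by two pieces pulls back to
   a cover of X by two closed sets.

   B is a forcing algebra: conditions are pairs of disjoint closed subsets of X,
   the first one meeting every closed discrete set finitely, and psi y (gmem) is
   the value of "y belongs to the union of the first components". This generic
   set is clopen along convergent sequences and meets closed discrete sets in
   finite sets; as X is countable, this yields continuity and compactness.

   X is built by attaching, for every pair of points z, w, a copy of the tree of
   finite sequences of integers in which the children of each node converge to z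
   and each infinite branch converges to w. A neighbourhood of z then contains a
   branch from its first step on, which a neighbourhood of w meets, so that X is
   irreducible, while convergent sequences have unique limits. *)
Require Import Defs.
From HB Require Import structures.
From mathcomp Require Import all_boot all_order all_classical.
From mathcomp Require Import finmap topology_structure compact.

Set Implicit Arguments.
Unset Strict Implicit.
Unset Printing Implicit Defensive.

Import Order.Theory.

Local Open Scope classical_set_scope.

(** * Directed covers of compact sets, and closed sets of the Scott topology *)

Lemma compact_directed_cover (X : topologicalType) (K : set X)
    (G : set (set X)) :
  cover_compact K -> G !=set0 ->
  (forall U V, G U -> G V -> exists2 W, G W & U `|` V `<=` W) ->
  G `<=` open -> K `<=` \bigcup_(U in G) U -> exists2 U, G U & K `<=` U.
Proof.
move=> cK [U0 GU0] dG oG KG.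
have [D' D'G KD'] := cK (set X) G id oG KG.
have bnd (s : seq (set X)) : (forall V, V \in s -> G V) ->
    exists2 U, G U & forall V, V \in s -> V `<=` U.
  elim: s => [_|V s IHs sG]; first by exists U0.
  have [|U GU sU] := IHs; first by move=> W Ws; apply: sG; rewrite inE Ws orbT.
  have [W GW UVW] := dG _ _ GU (sG V (mem_head _ _)).
  exists W => // V'; rewrite inE => /orP[/eqP ->|/sU V'U] x V'x; apply: UVW.
    by right.
  by left; exact: V'U.
have [|U GU D'U] := bnd (enum_fset D'); first by move=> V /D'G /set_mem.
by exists U => // x /KD'[V /= VD' Vx]; exact: D'U Vx.
Qed.

Section ScottSpace.
Context (d : Order.disp_t) (P : porderType d).
Implicit Types (U A D : set P) (x y s : P).

Lemma open_scottE U : @open (scott P) U = scott_open U.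
Proof. by []. Qed.

Lemma closed_scottP A :
  @closed (scott P) A <->
  (forall x y, A y -> (x <= y)%O -> A x) /\
  (forall D s, directed D -> D `<=` A -> supremums D s -> A s).
Proof.
rewrite -openC open_scottE; split=> [[Aup Aop]|[Adown Asup]].
  split=> [x y Ay xy|D s dD DA sD].
    by apply: contrapT => nAx; exact: Aup nAx xy Ay.
  by apply: contrapT => /(Aop _ _ dD sD)[x [/DA]].
split=> [x y nAx xy /Adown|D s dD sD nAs]; first by move=> /(_ _ xy).
apply: contrapT => DA; apply: nAs; apply: Asup dD _ sD => x Dx.
by apply: contrapT => nAx; apply: DA; exists x.
Qed.

Lemma closed_down x : @closed (scott P) [set y | (y <= x)%O].
Proof.
apply/closed_scottP; split=> [y z /= zx yz|D s dD Dx [_ lD]].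
  exact: le_trans zx.
by apply: lD => y /Dx.
Qed.

Lemma closure_scott1 x : @closure (scott P) [set x] = [set y | (y <= x)%O].
Proof.
rewrite closureE; apply/seteqP; split=> y.
  by apply; split; [exact: closed_down|move=> _ -> /=].
move=> /= yx A [/closed_scottP[Adown _] Ax].
by apply: Adown yx; exact: Ax.
Qed.

Lemma specialization_scottE x y :
  @specialization_le (scott P) x y <-> (x <= y)%O.
Proof. by rewrite /specialization_le closure_scott1. Qed.

Lemma saturated_scottP (K : set P) :
  @saturated (scott P) K <-> upper_set K.
Proof.
split=> [[F Fo ->] x y Kx xy U FU|Kup].
  by apply: (Fo _ FU).1 xy; exact: Kx.
exists [set U | exists2 x, ~ K x & U = [set y | ~~ (y <= x)%O]].
  move=> _ [x nKx ->].
  suff -> : [set y | ~~ (y <= x)%O] = ~` [set y | (y <= x)%O].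
    by rewrite openC; exact: closed_down.
  by apply/seteqP; split=> y /= /negP.
apply/seteqP; split=> [y Ky _ [x nKx ->] /=|y Ky].
  by apply/negP => yx; apply: nKx; exact: Kup yx.
apply: contrapT => nKy.
by have := Ky _ (ex_intro2 _ _ y nKy erefl); rewrite /= lexx.
Qed.

End ScottSpace.

(** * Well-filteredness of complete lattices *)

Section CompleteLattice.
Context (d : Order.disp_t) (L : latticeType d).
Implicit Types (A K D : set L) (F : set (set L)) (x y : L).

Lemma directed_join D x : directed D -> directed [set Order.join z x | z in D].
Proof.
move=> [[z Dz] dD]; split; first by exists (Order.join z x), z.
move=> _ _ [u Du <-] [v Dv <-]; have [w [Dw uw vw]] := dD _ _ Du Dv.
by exists (Order.join w x); split; [exists w| |]; rewrite // leU2.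
Qed.

Lemma supremums_join D s x : directed D -> supremums D s ->
  supremums [set Order.join z x | z in D] (Order.join s x).
Proof.
move=> [[z Dz] _] [uD lD]; split=> [_ [w Dw <-]|b ub].
  by rewrite leU2 // uD.
have bx w : D w -> (w <= b)%O && (x <= b)%O.
  by move=> Dw; rewrite -leUx; apply: ub; exists w.
rewrite leUx; have /andP[_ ->] := bx z Dz; rewrite andbT.
by apply: lD => w /bx/andP[].
Qed.

Lemma closed_join_preimage A x : @closed (scott L) A ->
  @closed (scott L) [set y | A (Order.join y x)].
Proof.
move=> /closed_scottP[Adown Asup]; apply/closed_scottP; split=> [y z /= Az yz|].
  by apply: Adown Az _; rewrite leU2.
move=> D s dD DA sD /=.
apply: Asup (directed_join x dD) _ (supremums_join x dD sD).
by move=> _ [z /DA Az <-].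
Qed.

Lemma compact_closed_filtered K (G : set (set L)) :
  @cover_compact (scott L) K -> G !=set0 ->
  (forall C, G C -> @closed (scott L) C) ->
  (forall C1 C2, G C1 -> G C2 -> exists2 C, G C & C `<=` C1 `&` C2) ->
  (forall C, G C -> K `&` C !=set0) ->
  K `&` \bigcap_(C in G) C !=set0.
Proof.
move=> cK [C0 GC0] cG fG KG; apply: contrapT => K0.
have [||||_ [C GC <-] KC] :=
  @compact_directed_cover (scott L) K [set ~` C | C in G] cK.
- by exists (~` C0), C0.
- move=> _ _ [C1 G1 <-] [C2 G2 <-]; have [C GC CC] := fG _ _ G1 G2.
  by exists (~` C); [exists C|rewrite -setCI; exact: subsetC].
- by move=> _ [C GC <-]; rewrite openC; exact: cG.
- move=> k Kk; apply: contrapT => nk; apply: K0; exists k; split=> // C GC.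
  by apply: contrapT => nCk; apply: nk; exists (~` C) => //; exists C.
by have [k [/KC]] := KG _ GC.
Qed.

(** As [K] is upper and [A] lower, these are the points below some common point of [A] and [K]. For
    a directed [D], the closed sets of [y] with [A (Order.join y x)], [x] in [D], are filtered and
    meet [K], so a single [k] serves all of [D]. *)
Lemma closed_down_compact A K : @closed (scott L) A ->
  @cover_compact (scott L) K -> upper_set K ->
  @closed (scott L) [set x | exists2 k, K k & A (Order.join x k)].
Proof.
move=> cA cK Kup; have [Adown Asup] := (closed_scottP A).1 cA.
apply/closed_scottP; split=> [x y /= [k Kk Ayk] xy|D s dD DA sD].
  by exists k => //; apply: Adown Ayk _; rewrite leU2.
have [[x0 Dx0] dirD] := dD.
have [||||k [Kk kD]] :=
  @compact_closed_filtered K [set [set y | A (Order.join y x)] | x in D] cK.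
- by exists [set y | A (Order.join y x0)], x0.
- by move=> _ [x Dx <-]; exact: closed_join_preimage.
- move=> _ _ [x Dx <-] [y Dy <-]; have [z [Dz xz yz]] := dirD _ _ Dx Dy.
  exists [set u | A (Order.join u z)]; first by exists z.
  by move=> u /= Au; split; apply: Adown Au _; rewrite leU2.
- by move=> _ [x /DA[k Kk Axk] <-]; exists k; split; rewrite //= joinC.
exists k => //; apply: Asup (directed_join k dD) _ (supremums_join k dD sD).
move=> _ [x Dx <-]; rewrite joinC.
by apply: (kD [set y | A (Order.join y x)]); exists x.
Qed.

(** A nonempty chain in [A] is directed, so its supremum stays in [A] and Zorn's lemma applies. *)
Lemma closed_maximal A : complete_lattice L -> @closed (scott L) A ->
  A !=set0 -> exists2 m, A m & forall y, A y -> (m <= y)%O -> y = m.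
Proof.
move=> cL /closed_scottP[Adown Asup] [x Ax].
pose R (s t : {x | A x}) := (sval s <= sval t)%O.
have [|r s t|s t st ts|C Ctot|[m Am] mmax] := @Zorn {x | A x} R.
- by move=> s; exact: lexx.
- exact: le_trans.
- by apply: eq_sig_hprop => /=; [move=> ? ? ?; exact: Prop_irrelevance|
    apply/eqP; rewrite eq_le; apply/andP; split].
- have [[c Cc]|C0] := pselect (C !=set0); last first.
    by exists (exist _ x Ax) => s Cs; case: C0; exists s.
  have [[s sC] _] := cL [set sval t | t in C].
  have As : A s.
    apply: Asup sC; last by move=> _ [[y Ay] _ <-].
    split; first by exists (sval c), c.
    move=> _ _ [u Cu <-] [v Cv <-]; have [uv|vu] := Ctot _ _ Cu Cv.
      by exists (sval v); split => //; exists v.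
    by exists (sval u); split => //; exists u.
  by exists (exist _ s As) => t Ct; case: sC => us _; apply: us; exists t.
by exists m => // y Ay my; have [] := mmax (exist _ y Ay) my.
Qed.

(** A maximal point [m] of the intersection [P] of the closed sets [down K] belongs to every [K] in
    [F], hence to [U]; yet [m] lies below a point of [A], the complement of [U]. *)
Lemma complete_lattice_well_filtered :
  complete_lattice L -> well_filtered (scott L).
Proof.
move=> cL F U FQ [[K0 FK0] fF] oU FU; apply: contrapT => nFU.
have FC K : F K -> @cover_compact (scott L) K by move=> /FQ[].
have Fup K : F K -> upper_set K by move=> /FQ[_ _] /saturated_scottP.
pose A := ~` U; have cA : @closed (scott L) A by rewrite closedC.
have [Adown Asup] := (closed_scottP A).1 cA.
have FA K : F K -> K `&` A !=set0.
  move=> FK; apply: contrapT => KA; apply: nFU; exists K => // x Kx.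
  by apply: contrapT => nUx; apply: KA; exists x.
pose down K := [set x : L | exists2 k, K k & A (Order.join x k)].
have cdown K : F K -> @closed (scott L) (down K).
  by move=> FK; apply: closed_down_compact cA (FC _ FK) (Fup _ FK).
pose P := \bigcap_(K in F) down K.
have cP : @closed (scott L) P by apply: closed_bigI.
have P0 : P !=set0.
  have [[s0 [us0 ls0]] _] := cL set0; exists s0 => K FK /=.
  have [k [Kk Ak]] := FA K FK; exists k => //.
  by rewrite (join_idPr _) //; exact: ls0.
have [m Pm mmax] := closed_maximal cL cP P0.
suff Fm K : F K -> K m.
  have [k K0k Ak] := Pm _ FK0; have : A m.
    by apply: Adown Ak _; exact: leUl.
  by apply; exact: FU.
(* Compactness yields [k] in [K] with [Order.join k m] in [P]; maximality of [m] then puts [m] above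
   [k]. *)
move=> FK; have [|C GC|C1 C2|C GC|k [Kk kF]] :=
    @compact_closed_filtered K
    [set [set y | down K' (Order.join y m)] | K' in F] (FC _ FK).
- by exists [set y | down K0 (Order.join y m)], K0.
- by case: GC => K' FK' <-; exact: closed_join_preimage (cdown _ FK').
- move=> [K1 FK1 <-] [K2 FK2 <-]; have [K' FK' K'12] := fF _ _ FK1 FK2.
  exists [set y | down K' (Order.join y m)]; first by exists K'.
  by move=> y /= [k /K'12[K1k K2k] Ak]; split; exists k.
(* With [K'] inside both [K] and [K1], the witness of [down K' m] serves for both. *)
- case: GC => K1 FK1 <-; have [K' FK' K'K] := fF _ _ FK FK1.
  have [k' K'k' Ak'] := Pm _ FK'; have [Kk' K1k'] := K'K _ K'k'.
  by exists k'; split => //; exists k' => //; rewrite /= joinAC joinxx joinC.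
apply: Fup FK _ _ Kk _.
rewrite -(mmax (Order.join k m)) ?leUl ?leUr // => K' FK'.
by apply: (kF [set y | down K' (Order.join y m)]); exists K'.
Qed.

End CompleteLattice.

(** * A criterion for Boolean algebras *)

Section BooleanScott.
Context (d : Order.disp_t) (B : ctbDistrLatticeType d).
Implicit Types (K D : set B) (x y : B).

(** If the complement of [s] were outside [K], the open sets of [w] with [x] not below the
    complement of [w], for [x] in [D], would be a directed cover of [K]. One of them would contain
    [K], yet it misses the complement of [x]. *)
Lemma closed_compl_compact K : @cover_compact (scott B) K -> upper_set K ->
  @closed (scott B) [set x | K (~` x)%O].
Proof.
move=> cK Kup; apply/closed_scottP.
split=> [x y /= Ky xy|D s [[x0 Dx0] dD] DK sD /=].
  by apply: Kup Ky _; rewrite leC.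
have [us ls] := sD; apply: contrapT => nKs.
have [||||_ [x Dx <-] Kx] := @compact_directed_cover (scott B) K
  [set [set w | ~~ (x <= ~` w)%O] | x in D] cK.
- by exists [set w | ~~ (x0 <= ~` w)%O], x0.
- move=> _ _ [x Dx <-] [y Dy <-]; have [z [Dz xz yz]] := dD _ _ Dx Dy.
  exists [set w | ~~ (z <= ~` w)%O]; first by exists z.
  by move=> w /= [] /negP nxw; apply/negP; move: nxw => /[swap] zw;
    apply; exact: le_trans zw.
- move=> _ [x Dx <-]; rewrite open_scottE.
  split=> [u v /= /negP nu uv|E t _ [ut lt] /= /negP nt].
    by apply/negP => xv; apply: nu; apply: le_trans xv _; rewrite leC.
  apply: contrapT => nE; apply: nt; rewrite lexC; apply: lt => w Ew.
  by rewrite lexC; apply: contrapT => /negP nw; apply: nE; exists w.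
- move=> w Kw; apply: contrapT => nw; apply: nKs; apply: Kup Kw _.
  rewrite lexC; apply: ls => x Dx; apply: contrapT => /negP nx.
  by apply: nw; exists [set w | ~~ (x <= ~` w)%O] => //; exists x.
by have /negP := Kx _ (DK _ Dx); rewrite complK lexx.
Qed.

End BooleanScott.

Section Criterion.
Context (d : Order.disp_t) (B : ctbDistrLatticeType d).
Context (X : topologicalType) (psi : X -> B).
Context (psi_cont : forall U : set B, scott_open U -> open (psi @^-1` U)).
Context (X_irr : irreducible [set: X]).
Context (psi_nomax : forall y, exists z, ~~ (psi z <= psi y)%O).

Let K : set B := [set x | exists y, (~` psi y <= x)%O].
Context (K_compact : @cover_compact (scott B) K).

Let K_upper : upper_set K.
Proof. by move=> x z [y yx] xz; exists y; exact: le_trans xz. Qed.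

Let psi_closed (A : set B) : @closed (scott B) A -> closed (psi @^-1` A).
Proof.
move=> cA; rewrite -openC; apply: (@psi_cont (~` A)).
by rewrite -open_scottE openC.
Qed.

Let K_psi y : K (~` psi y)%O. Proof. by exists y. Qed.

(** A generic point of the lower closure of the range of [psi] would lie below some [psi y] and
    above every [psi z]. *)
Lemma not_sober_of_continuous : ~ sober (scott B).
Proof.
move=> sob; have [X0 Xirr] := X_irr.
have cK : @closed (scott B) [set x | K (~` x)%O] by exact: closed_compl_compact.
have [|x [Ex _]] := sob _ cK.
  split=> [|F1 F2 cF1 cF2 KF].
    by have [y _] := X0; exists (psi y); exact: K_psi.
  have sub F : @closed (scott B) F -> [set: X] `<=` psi @^-1` F ->
      [set x | K (~` x)%O] `<=` F.
    move=> /closed_scottP[Fdown _] XF x [y]; rewrite leC => xy.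
    by apply: (Fdown _ _ (XF y I) xy).
  have [||y _|/(sub _ cF1)|/(sub _ cF2)] :=
    Xirr (psi @^-1` F1) (psi @^-1` F2); try exact: psi_closed.
  - by apply: KF; exact: K_psi.
  - by left.
  - by right.
have : [set x | K (~` x)%O] x by rewrite Ex closure_scott1 /=.
move=> [y]; rewrite leC => xy; have [z /negP] := psi_nomax y; apply.
apply: le_trans xy; have : [set x | K (~` x)%O] (psi z) by exact: K_psi.
by rewrite Ex closure_scott1.
Qed.

Lemma not_co_sober_of_continuous : ~ co_sober (scott B).
Proof.
move=> cosob; have [X0 Xirr] := X_irr.
have [|x Kx] := cosob K; last first.
  have : K x by rewrite Kx; apply/specialization_scottE.
  move=> [y yx]; have [z /negP] := psi_nomax y; apply.
  rewrite -leC; apply: le_trans yx _; apply/specialization_scottE.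
  by have := K_psi z; rewrite {1}Kx.
split=> [|K1 K2 [_ cK1 /saturated_scottP K1up]
               [_ cK2 /saturated_scottP K2up] KE].
  split=> //; last exact/saturated_scottP.
  by have [y _] := X0; exists (~` psi y)%O; exact: K_psi.
have sub K' : upper_set K' ->
    [set: X] `<=` psi @^-1` [set x | K' (~` x)%O] -> K `<=` K'.
  by move=> K'up XK' x [y yx]; exact: (K'up _ _ (XK' y I) yx).
have [||y _|X1|X2] := Xirr (psi @^-1` [set x | K1 (~` x)%O])
                           (psi @^-1` [set x | K2 (~` x)%O]).
- by apply: psi_closed; exact: closed_compl_compact.
- by apply: psi_closed; exact: closed_compl_compact.
- by have := K_psi y; rewrite KE.
- by left; apply/seteqP; split; [exact: sub|rewrite KE; exact: subsetUl].
- by right; apply/seteqP; split; [exact: sub|rewrite KE; exact: subsetUr].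
Qed.

End Criterion.

(** * The algebra of regular subsets of a preorder *)

Section Regular.
Context (d : Order.disp_t) (Q : preorderType d).
Implicit Types (A C : set Q) (p q r : Q).

(** Forcing negation, that is, the exterior of [A] in the topology of lower sets; [regular] sets are
    then the regular open sets. *)
Definition sneg A : set Q := [set p | forall q, (q <= p)%O -> ~ A q].

Definition lower_set A := forall p q, A p -> (q <= p)%O -> A q.

Definition regular A := sneg (sneg A) = A.

Lemma sneg_lower A : lower_set (sneg A).
Proof. by move=> p q nA qp r rq; apply: nA; exact: le_trans qp. Qed.

Lemma sneg_anti A C : A `<=` C -> sneg C `<=` sneg A.
Proof. by move=> AC p nC q /nC nq /AC. Qed.

Lemma sub_snegK A : lower_set A -> A `<=` sneg (sneg A).
Proof. by move=> lA p Ap q qp /(_ q (lexx _)); apply; exact: lA qp. Qed.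

Lemma sneg_regular A : lower_set A -> regular (sneg A).
Proof.
move=> lA; apply/seteqP; split; last exact/sub_snegK/sneg_lower.
exact/sneg_anti/sub_snegK.
Qed.

Lemma regular_lower A : regular A -> lower_set A.
Proof. by move=> <-; exact: sneg_lower. Qed.

Lemma regularP A : lower_set A ->
  (forall p, (forall q, (q <= p)%O -> exists2 r, (r <= q)%O & A r) -> A p) ->
  regular A.
Proof.
move=> lA dA; apply/seteqP; split; last exact: sub_snegK.
move=> p nnp; apply: dA => q qp; apply: contrapT => nr.
by apply: (nnp q qp) => r rq Ar; apply: nr; exists r.
Qed.

Lemma regular_dense A p : regular A ->
  (forall q, (q <= p)%O -> exists2 r, (r <= q)%O & A r) -> A p.
Proof.
move=> rA dA; rewrite -rA => q qp nA; have [r rq Ar] := dA q qp.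
exact: nA rq Ar.
Qed.

Lemma regular_bigcap I (D : set I) (F : I -> set Q) :
  (forall i, D i -> regular (F i)) -> regular (\bigcap_(i in D) F i).
Proof.
move=> rF; apply: regularP => [p q Fp qp i Di|p dp i Di].
  exact: (regular_lower (rF i Di)) (Fp i Di) qp.
apply: (regular_dense (rF i Di)) => q qp.
by have [r rq Fr] := dp q qp; exists r => //; exact: Fr.
Qed.

Lemma regularT : regular setT.
Proof. exact: regularP. Qed.

Lemma regularI A C : regular A -> regular C -> regular (A `&` C).
Proof.
move=> rA rC; rewrite -bigcap2E; apply: regular_bigcap => -[|[|n]] //= _.
exact: regularT.
Qed.

Record regset := Regset { rset :> set Q; rsetP : `[< regular rset >] }.

HB.instance Definition _ := [isSub for rset].
HB.instance Definition _ := [Choice of regset by <:].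

Implicit Types (a b c : regset).

Lemma rset_regular a : regular a. Proof. exact/asboolP/rsetP. Qed.

Lemma rset_lower a : lower_set a.
Proof. exact: regular_lower (rset_regular a). Qed.

Definition to_regset A (rA : regular A) := Regset (asboolT rA).

Definition rle a b : bool := `[< rset a `<=` rset b >].

Lemma rle_refl : reflexive rle. Proof. by move=> a; apply/asboolP => p. Qed.

Lemma rle_anti : antisymmetric rle.
Proof.
by move=> a b /andP[/asboolP ab /asboolP ba]; apply/val_inj/seteqP.
Qed.

Lemma rle_trans : transitive rle.
Proof.
by move=> b a c /asboolP ab /asboolP bc; apply/asboolP => p /ab/bc.
Qed.

HB.instance Definition _ :=
  Order.Le_isPOrder.Build d regset rle_refl rle_anti rle_trans.

Lemma rleP a b : reflect (rset a `<=` rset b) (a <= b)%O.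
Proof. exact: asboolP. Qed.

Definition rmeet a b := to_regset (regularI (rset_regular a) (rset_regular b)).

(** A union of regular sets need not be regular, hence the double negation. *)
Definition rjoin a b :=
  to_regset (sneg_regular (@sneg_lower (rset a `|` rset b))).

Definition rcompl a := to_regset (sneg_regular (@rset_lower a)).

Lemma rmeetP a b c : (a <= rmeet b c)%O = (a <= b)%O && (a <= c)%O.
Proof.
apply/rleP/andP => [abc|[/rleP ab /rleP ac] p ap]; last first.
  by split; [exact: ab|exact: ac].
by split; apply/rleP => p /abc[].
Qed.

Lemma lower_setU A C : lower_set A -> lower_set C -> lower_set (A `|` C).
Proof.
by move=> lA lC p q [Ap|Cp] qp; [left; exact: lA qp|right; exact: lC qp].
Qed.

Lemma rjoinP a b c : (rjoin a b <= c)%O = (a <= c)%O && (b <= c)%O.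
Proof.
apply/rleP/andP => [abc|[/rleP ac /rleP bc]].
  have sub := sub_snegK (lower_setU (@rset_lower a) (@rset_lower b)).
  by split; apply/rleP => p xp; apply/abc/sub; [left|right].
rewrite -(rset_regular c) /=; apply/sneg_anti/sneg_anti => p [/ac|/bc] //.
Qed.

HB.instance Definition _ :=
  Order.POrder_MeetJoin_isLattice.Build d regset rmeetP rjoinP.

Lemma rmeetUl : @left_distributive regset regset Order.meet Order.join.
Proof.
move=> a b c; apply/le_anti/andP; split; last first.
  by rewrite leUx !leI2 ?leUl ?leUr.
apply/rleP => p [/= nnp cp] q qp nq; apply: (nnp q qp) => r rq abr.
apply: (nq r rq); have cr : rset c r.
  by apply: rset_lower cp _; exact: le_trans qp.
by case: abr => xr; [left|right].
Qed.

HB.instance Definition _ :=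
  Order.Lattice_Meet_isDistrLattice.Build d regset rmeetUl.

Lemma rbottomP a : (to_regset (sneg_regular (regular_lower regularT)) <= a)%O.
Proof. by apply/rleP => p /(_ p (lexx p)); case. Qed.

HB.instance Definition _ := Order.hasBottom.Build d regset rbottomP.

Lemma rtopP a : (a <= to_regset regularT)%O.
Proof. by apply/rleP => p. Qed.

HB.instance Definition _ := Order.hasTop.Build d regset rtopP.

Lemma rmeetxC a : (a `&` rcompl a)%O = \bot%O.
Proof.
apply/le_anti; rewrite le0x andbT; apply/rleP => p [ap /(_ p (lexx p))].
by [].
Qed.

Lemma rjoinxC a : (a `|` rcompl a)%O = \top%O.
Proof.
apply/le_anti; rewrite lex1 /=; apply/rleP => p _ /= q _ nq.
have nna : sneg (sneg a) q by move=> r rq nar; apply: (nq r rq); right.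
by apply: (nq q (lexx q)); left; rewrite -(rset_regular a).
Qed.

HB.instance Definition _ :=
  Order.TBDistrLattice_hasComplement.Build d regset rjoinxC rmeetxC.

Lemma rset_complE a : rset (~` a)%O = sneg a.
Proof. by []. Qed.

Lemma supremums_dense (D : set regset) s : ubound D s ->
  (forall p, rset s p -> exists2 q, (q <= p)%O & exists2 a, D a & rset a q) ->
  supremums D s.
Proof.
move=> us ds; split=> // b ub; apply/rleP => p sp.
apply: (regular_dense (rset_regular b)) => q qp.
have [r rq [a /ub/rleP ab /ab br]] := ds q (rset_lower sp qp).
by exists r.
Qed.

Lemma regset_complete : complete_lattice regset.
Proof.
move=> A; split.
  have lA : lower_set (\bigcup_(a in A) rset a).
    by move=> p q [a Aa ap] qp; exists a => //; exact: rset_lower qp.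
  exists (to_regset (sneg_regular (@sneg_lower (\bigcup_(a in A) rset a)))).
  split=> [a Aa|b ub]; apply/rleP => p.
    by move=> ap; apply: (sub_snegK lA); exists a.
  move=> nnp; rewrite -(rset_regular b); move: p nnp; apply/sneg_anti/sneg_anti.
  by move=> p [a /ub/rleP]; exact.
exists (to_regset (regular_bigcap (fun a (_ : A a) => rset_regular a))).
split=> [a Aa|b lb]; apply/rleP => p; first exact.
by move=> bp a /lb/rleP; exact.
Qed.

End Regular.

(** * Forcing a generic subset of a space *)

Section Tail.
Context (d : Order.disp_t) (Q : preorderType d) (I : Type).
Implicit Types (U : set (regset Q)) (E F : set I).

(* Below x, the values a e are forced to hold for almost all e in E: x is the
   directed supremum of its meets with the infima of a over cofinite subsets. *)
Lemma scott_open_tail (a : I -> regset Q) (x : regset Q) E U :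
  (forall p, rset x p -> exists2 q, (q <= p)%O &
    exists2 F, finite_set F & forall e, E e -> ~ F e -> rset (a e) q) ->
  scott_open U -> U x -> finite_set [set e | E e /\ ~ U (a e)].
Proof.
move=> xE [Uup Uop] Ux.
pose m F : regset Q := to_regset (regular_bigcap (fun e (_ : (E `\` F) e) =>
  rset_regular (a e))).
pose D := [set (x `&` m F)%O | F in [set F | finite_set F]].
have m_anti F G : F `<=` G -> (m F <= m G)%O.
  by move=> FG; apply/rleP => p mp e [Ee nGe]; apply: mp; split=> // /FG.
have [|||_ [[F finF <-] UF]] := Uop D x.
- split.
    by exists (x `&` m set0)%O; exists set0; first exact: finite_set0.
  move=> _ _ [F fF <-] [G fG <-]; exists (x `&` m (F `|` G))%O; split.
  + by exists (F `|` G) => //; rewrite /= finite_setU.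
  + by rewrite leI2 // m_anti //; exact: subsetUl.
  + by rewrite leI2 // m_anti //; exact: subsetUr.
- apply: supremums_dense => [_ [F _ <-]|p xp]; first exact: leIl.
  have [q qp [F finF FE]] := xE p xp; exists q => //.
  exists (x `&` m F)%O; first by exists F.
  by split; [exact: rset_lower xp qp|move=> e [Ee nFe]; exact: FE].
- exact: Ux.
(* For [e] in [E] outside [F], the element of [U] just found lies below [a e]. *)
apply: sub_finite_set finF => e [Ee nUe]; apply: contrapT => nFe; apply: nUe.
apply: Uup UF _; apply: le_trans (leIr _ _) _.
by apply/rleP => p; apply.
Qed.

End Tail.

Section Conditions.
Context (X : topologicalType).
Implicit Types (A E F S : set X) (y : X).

(** Equivalently, [E] is closed and discrete as a subspace. *)
Definition discrete_closed E := forall F, F `<=` E -> closed F.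

Definition finite_trace A :=
  forall E, discrete_closed E -> finite_set (A `&` E).

(* The last clause makes y the only limit of every infinite subset of S. *)
Definition tends_to S y :=
  [/\ infinite_set S, forall U, open U -> U y -> finite_set (S `\` U) &
      forall F, F `<=` S -> closed (F `|` [set y])].

(* cin is forced to be contained in the generic set, cout to be disjoint from
   it. *)
Record cond := Cond {
  cin : set X;
  cout : set X;
  cin_closed : closed cin;
  cout_closed : closed cout;
  cin_cout : forall y, cin y -> ~ cout y;
  cin_trace : finite_trace cin
}.

HB.instance Definition _ := gen_eqMixin cond.
HB.instance Definition _ := gen_choiceMixin cond.

Definition cond_le (p q : cond) : bool :=
  `[< cin q `<=` cin p /\ cout q `<=` cout p >].

Lemma cond_le_refl : reflexive cond_le.
Proof. by move=> p; apply/asboolP; split. Qed.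

Lemma cond_le_trans : transitive cond_le.
Proof.
move=> q p r /asboolP[pq pq'] /asboolP[qr qr']; apply/asboolP.
by split; [exact: subset_trans pq|exact: subset_trans pq'].
Qed.

Fact cond_display : Order.disp_t. Proof. exact: Order.Disp tt tt. Qed.

HB.instance Definition _ :=
  Order.Le_isPreorder.Build cond_display cond cond_le_refl cond_le_trans.

Lemma cond_leP (p q : cond) :
  reflect (cin q `<=` cin p /\ cout q `<=` cout p) (p <= q)%O.
Proof. exact: asboolP. Qed.

Lemma finite_traceU A C :
  finite_trace A -> finite_trace C -> finite_trace (A `|` C).
Proof.
by move=> fA fC E dE; rewrite setIUl finite_setU; split; [exact: fA|exact: fC].
Qed.

Lemma extend_cin (p : cond) A : closed A -> finite_trace A ->
  (forall y, A y -> ~ cout p y) -> exists2 q : cond, (q <= p)%O & A `<=` cin q.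
Proof.
move=> cA fA Ap.
have cU := closedU (@cin_closed p) cA.
have fU := finite_traceU (@cin_trace p) fA.
have dj y : (cin p `|` A) y -> ~ cout p y by case=> [/cin_cout|/Ap].
exists (Cond cU (@cout_closed p) dj fU).
  by apply/cond_leP; split=> // y; left.
by move=> y; right.
Qed.

Lemma extend_cout (p : cond) A : closed A ->
  (forall y, A y -> ~ cin p y) -> exists2 q : cond, (q <= p)%O & A `<=` cout q.
Proof.
move=> cA Ap; have cU := closedU (@cout_closed p) cA.
have dj y : cin p y -> ~ (cout p `|` A) y.
  by move=> py [|/Ap] //; exact: cin_cout.
exists (Cond (@cin_closed p) cU dj (@cin_trace p)).
  by apply/cond_leP; split=> // y; left.
by move=> y; right.
Qed.

(** The points of [E] other than [y] form a closed set missing [y], so only finitely many of them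
    lie in [S]. *)
Lemma tends_to_finite_trace S y F : closed [set y] -> tends_to S y ->
  F `<=` S -> finite_trace (F `|` [set y]).
Proof.
move=> cy [_ convS _] FS E dE; rewrite setIUl finite_setU; split; last first.
  exact: sub_finite_set (@subIsetl _ _ _) (finite_set1 y).
have : finite_set (S `\` ~` (E `\ y)).
  apply: convS; first by rewrite openC; apply: dE => z [].
  by move=> [_ ny]; exact: ny.
move=> fS; apply: (@sub_finite_set _ _ ((S `\` ~` (E `\ y)) `|` [set y])).
  move=> z [/FS Sz Ez]; have [->|zy] := pselect (z = y); first by right.
  by left; split => // nE; exact: nE.
by rewrite finite_setU; split.
Qed.

End Conditions.

Section GenericSet.
Context (X : topologicalType).
Implicit Types (y z : X) (E S : set X).
Context (X_T1 : forall y, closed [set y]).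
Context (X_seq : forall A : set X, ~ closed A ->
  exists y S, [/\ ~ A y, S `<=` A & tends_to S y]).

Local Notation B := (regset (cond X)).

Lemma finite_trace1 y : finite_trace [set y].
Proof.
by move=> E _; exact: sub_finite_set (@subIsetl _ _ _) (finite_set1 y).
Qed.

(** When [y] is not in [cin p], it can be added to [cout p], and then no extension has it in
    [cin]. *)
Lemma cin_regular y : regular [set p : cond X | cin p y].
Proof.
apply: regularP => [p q /= py /cond_leP[pq _]|p dp /=]; first exact: pq.
apply: contrapT => npy.
have [z ->|q qp yq] := @extend_cout _ p [set y] (@X_T1 y); first exact: npy.
have [r /cond_leP[_ qr] /cin_cout] := dp q qp; apply; apply: qr.
exact: yq.
Qed.

Definition gmem y : B := to_regset (cin_regular y).

Lemma compl_gmemP y (p : cond X) : rset (~` gmem y)%O p <-> cout p y.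
Proof.
rewrite rset_complE; split=> [np|py q /cond_leP[_ pq] /cin_cout]; last first.
  by apply; exact: pq.
apply: contrapT => npy.
have [z ->|q qp yq] := extend_cin (@X_T1 y) (@finite_trace1 y) (p := p).
  exact: npy.
exact: np q qp (yq y erefl).
Qed.

(** If [y] is in [cin p], the closed set [cout p] misses [y], so it contains finitely many points of
    [S]; all the others can be added to [cin p]. *)
Lemma gmem_tends_to U S y : scott_open U -> U (gmem y) -> tends_to S y ->
  finite_set [set e | S e /\ ~ U (gmem e)].
Proof.
move=> oU Uy tS; have [_ convS clS] := tS.
apply: scott_open_tail oU Uy => p /= py.
have fS : finite_set (S `&` cout p).
  rewrite -(setCK (cout p)) -setDE; apply: convS; last exact: cin_cout.
  by rewrite openC; exact: cout_closed.
have SS : S `\` cout p `<=` S by move=> z [].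
have [z [[_ //]|-> /(cin_cout py)//]|q qp Sq] := extend_cin (clS _ SS)
  (tends_to_finite_trace (@X_T1 y) tS SS) (p := p).
exists q => //; exists (S `&` cout p) => // e Se ne.
by apply: Sq; left; split=> // oe; apply: ne.
Qed.

Lemma compl_gmem_tends_to U S y : scott_open U -> U (~` gmem y)%O ->
  tends_to S y -> finite_set [set e | S e /\ ~ U (~` gmem e)%O].
Proof.
move=> oU Uy [_ convS clS].
apply: scott_open_tail oU Uy => p /compl_gmemP py.
have fS : finite_set (S `&` cin p).
  rewrite -(setCK (cin p)) -setDE; apply: convS; last by move=> /cin_cout.
  by rewrite openC; exact: cin_closed.
have SS : S `\` cin p `<=` S by move=> z [].
have [z [[_ //]|-> /cin_cout//]|q qp Sq] := extend_cout (clS _ SS) (p := p).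
exists q => //; exists (S `&` cin p) => // e Se ne.
by apply/compl_gmemP/Sq; left; split=> // oe; apply: ne.
Qed.

(** This is the purpose of [finite_trace]: [cin p] contains finitely many points of [E], and the
    others can be added to [cout p], whatever [p] is. *)
Lemma compl_gmem_discrete U E : scott_open U -> U !=set0 -> discrete_closed E ->
  finite_set [set e | E e /\ ~ U (~` gmem e)%O].
Proof.
move=> oU [x Ux] dE; have UT : U \top%O by apply: oU.1 Ux (lex1 _).
apply: scott_open_tail oU UT => p _.
have fE := @cin_trace _ p E dE.
have EE : E `\` cin p `<=` E by move=> z [].
have [z [_ //]|q qp Eq] := extend_cout (dE _ EE) (p := p).
exists q => //; exists (cin p `&` E) => // e Ee ne.
by apply/compl_gmemP/Eq; split=> // oe; apply: ne.
Qed.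

Lemma gmem_continuous (U : set B) : scott_open U -> open (gmem @^-1` U).
Proof.
move=> oU; rewrite -closedC; apply: contrapT => /X_seq[y [S [yU SU tS]]].
have Uy : U (gmem y) by apply: contrapT.
have [infS _ _] := tS; apply: infS.
apply: sub_finite_set (gmem_tends_to oU Uy tS) => e Se.
by split=> //; exact: SU.
Qed.

Lemma gmem_antichain y z : y <> z -> ~~ (gmem z <= gmem y)%O.
Proof.
move=> yz; apply/negP => /rleP zy.
have dj x : [set z] x -> ~ [set y] x.
  by move=> -> /= zy'; apply: yz; rewrite zy'.
exact/yz/(zy (Cond (@X_T1 z) (@X_T1 y) dj (@finite_trace1 z))).
Qed.

Context (X_count : exists c : X -> nat, injective c).

(** Without a finite subcover, countability gives a sequence [z] for which each chosen set [f (g y)]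
    contains the complement of [gmem e] for only finitely many [e] in the range. But the range is
    infinite, so it is closed discrete or contains some [S] tending to a point; either way one
    [f (g y)] receives almost all of an infinite set. *)
Lemma compl_gmem_compact :
  @cover_compact (scott B) [set x | exists y, (~` gmem y <= x)%O].
Proof.
move=> I D f fo Kf; have [c c_inj] := X_count.
have up i : D i -> upper_set (f i) by move=> /fo[].
have /choice[g gP] y : exists i, D i /\ f i (~` gmem y)%O.
  by have [|i Di fi] := Kf (~` gmem y)%O; [exists y|exists i].
have gD y : D (g y) := (gP y).1.
apply: contrapT => nfin.
have /choice[z zP] n :
    exists z, forall y, (c y < n)%N -> ~ f (g y) (~` gmem z)%O.
  apply: contrapT => nz; apply: nfin.
  have finN : finite_set [set g y | y in [set y | (c y < n)%N]].
    apply: finite_image; apply: (@sub_finite_set _ _ (c @^-1` `I_n)) => //.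
    by apply: finite_preimage => // ? ? _ _; exact: c_inj.
  exists (fset_set [set g y | y in [set y | (c y < n)%N]]).
    by move=> i; rewrite in_fset_set // => /set_mem[y _ <-]; apply/mem_set.
  move=> x [z zx]; apply: contrapT => nx; apply: nz; exists z => y yn fz.
  apply: nx; exists (g y) => /=; last exact: up fz zx.
  by rewrite in_fset_set //; apply/mem_set; exists y.
have fin y : finite_set [set e | range z e /\ f (g y) (~` gmem e)%O].
  apply: (@sub_finite_set _ _ (z @` `I_(c y).+1)); last exact/finite_image.
  move=> _ [[n _ <-] fn]; exists n => //=; rewrite ltnS leqNgt.
  apply/negP => cyn; exact: zP cyn fn.
have infE E y : E `<=` range z -> infinite_set E ->
    ~ finite_set [set e | E e /\ ~ f (g y) (~` gmem e)%O].
  move=> Ez infE finE; apply: infE; apply: (@sub_finite_set _ _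
    ([set e | E e /\ ~ f (g y) (~` gmem e)%O] `|`
     [set e | range z e /\ f (g y) (~` gmem e)%O])).
    2: by rewrite finite_setU.
  move=> e Ee; have [fe|nfe] := pselect (f (g y) (~` gmem e)%O); last by left.
  by right; split => //; exact: Ez.
have infz : infinite_set (range z).
  move=> finz.
  (* With all codes below [N], the choice of [z N] would avoid even the set [f (g (z N))], chosen to
     contain the complement of [gmem (z N)]. *)
  have [N cN] : exists N, forall n, (c (z n) < N)%N.
    have [s zs] := (finite_seqP _).1 finz.
    exists (\max_(e <- s) c e).+1 => n; rewrite ltnS.
    apply: (@leq_bigmax_seq _ s predT c) => //.
    have : range z (z n) by exists n.
    by rewrite zs.
  by apply: (zP N (z N) (cN N)); exact: (gP _).2.
have [dz|] := pselect (discrete_closed (range z)).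
  apply: (infE (range z) (z 0%N) _ infz) => //.
  apply: compl_gmem_discrete dz; first exact: fo.
  by exists (~` gmem (z 0%N))%O; exact: (gP _).2.
move=> /existsNP[E /not_implyP[Ez /X_seq[y [S [_ SE tS]]]]].
have [infS _ _] := tS.
apply: (infE S y _ infS); first exact: subset_trans Ez.
by apply: compl_gmem_tends_to tS; [exact: fo|exact: (gP _).2].
Qed.

End GenericSet.

(** * A countable irreducible space with unique sequential limits *)

(** The recursion attaches trees also to pairs of points that are themselves nodes of trees. *)
Inductive pt := root | node of pt & pt & seq nat.

Fixpoint pt_code (x : pt) : nat :=
  if x is node z w s then (choice.pickle (pt_code z, pt_code w, s)).+1 else 0.

Lemma pt_code_inj : injective pt_code.
Proof.
elim=> [|z IHz w IHw s] [|z' w' s'] // [] /(pcan_inj choice.pickleK).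
by move=> -[/IHz -> /IHw -> ->].
Qed.

(* An arrow is a sequence of points together with the limit that the topology
   imposes on it. *)
Variant arrow := Children of pt & pt & seq nat | Branch of pt & pt & nat -> nat.

Definition term (j : arrow) n : pt :=
  match j with
  | Children z w s => node z w (rcons s n)
  | Branch z w f => node z w (mkseq f n)
  end.

Definition target (j : arrow) : pt :=
  match j with Children z _ _ => z | Branch _ w _ => w end.

(** The finest topology in which every arrow converges to its target. *)
Definition pt_open (U : set pt) := forall j, U (target j) ->
  exists N, forall n, (N <= n)%N -> U (term j n).

Lemma pt_openT : pt_open setT.
Proof. by move=> j _; exists 0%N. Qed.

Lemma pt_openI : setI_closed pt_open.
Proof.
move=> U V oU oV j [/oU[M UM] /oV[N VN]]; exists (maxn M N) => n.
by rewrite geq_max => /andP[/UM ? /VN ?].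
Qed.

Lemma pt_open_bigcup (I : Type) (f : I -> set pt) :
  (forall i, pt_open (f i)) -> pt_open (\bigcup_i f i).
Proof.
move=> fo j [i _ /fo[N fN]]; exists N => n /fN ?.
by exists i.
Qed.

HB.instance Definition _ := gen_eqMixin pt.
HB.instance Definition _ := gen_choiceMixin pt.
HB.instance Definition _ :=
  isOpenTopological.Build pt pt_openT pt_openI pt_open_bigcup.

Lemma pt_openE (U : set pt) : open U = pt_open U.
Proof. by []. Qed.

Lemma pt_closedP (A : set pt) : closed A <->
  forall j, (forall N, exists2 n, (N <= n)%N & A (term j n)) -> A (target j).
Proof.
rewrite -openC pt_openE; split=> [oA j jA|cA j nA].
  apply: contrapT => /oA[N NA]; have [n Nn] := jA N.
  exact: NA.
apply: contrapT => nN; apply: nA; apply: cA => N.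
apply: contrapT => nn; apply: nN; exists N => n Nn /= An.
by apply: nn; exists n.
Qed.

Lemma term_inj j : injective (term j).
Proof.
case: j => [z w s|z w f] m n /= [].
  by move/rcons_inj => [].
by move/(congr1 size); rewrite !size_mkseq.
Qed.

(** Two arrows of the same kind with a common term lie in the same tree, hence share their target. A
    branch contains at most one child of a given node, which rules out the mixed cases. *)
Lemma term_almost_disjoint j k :
  (forall N, exists2 n, (N <= n)%N & exists m, term j n = term k m) ->
  target j = target k.
Proof.
case: j k => [z w s|z w f] [z' w' s'|z' w' f'] H.
- by have [n _ [m []]] := H 0%N.
(* The only child of [s] on the branch [f'] can be the one numbered [f' (size s)]. *)
- have [n Hn [m [_ _ e]]] := H (f' (size s)).+1.
  have sm : size s < m by rewrite -(size_mkseq f' m) -e size_rcons.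
  have := congr1 (fun t => nth 0%N t (size s)) e.
  rewrite nth_rcons ltnn eqxx nth_mkseq // => en.
  by rewrite en ltnn in Hn.
(* From this index on, the nodes of the branch are longer than the children of [s']. *)
- have [n Hn [m [_ _ e]]] := H (size s').+2.
  have := congr1 size e; rewrite size_mkseq size_rcons => en.
  by rewrite en ltnn in Hn.
- by have [n _ [m []]] := H 0%N.
Qed.

Lemma pt_T1 (y : pt) : closed [set y].
Proof.
apply/pt_closedP => j jy; have [n _ ny] := jy 0%N; have [m nm my] := jy n.+1.
suff mn : m = n by rewrite mn ltnn in nm.
by apply: (@term_inj j); rewrite my ny.
Qed.

(** Some arrow [j] visits [A] infinitely often while its target is outside; [S] consists of its
    terms in [A]. An arrow visiting a part of [S] infinitely often has the same target by
    [term_almost_disjoint]. *)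
Lemma pt_seq (A : set pt) : ~ closed A ->
  exists y S, [/\ ~ A y, S `<=` A & tends_to S y].
Proof.
move=> /pt_closedP/existsNP[j /not_implyP[jA nA]].
exists (target j), (range (term j) `&` A); split=> //.
split.
- move=> fin; have : finite_set (term j @^-1` (range (term j) `&` A)).
    by apply: finite_preimage fin => ? ? _ _; exact: term_inj.
  move=> /(finite_seqP _).1[s sE]; have [n sn An] := jA (\max_(i <- s) i).+1.
  have : (term j @^-1` (range (term j) `&` A)) n by split=> //; exists n.
  rewrite sE /= => ns; move: sn; rewrite ltnNge => /negP; apply.
  exact: (@leq_bigmax_seq _ s predT id).
- move=> U; rewrite pt_openE => oU /oU[N UN].
  apply: (@sub_finite_set _ _ (term j @` `I_N)).
    move=> _ [[[n _ <-] _] nU]; exists n => //=; rewrite ltnNge.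
    by apply/negP => /UN.
  exact/finite_image.
- move=> F FA; apply/pt_closedP => k kF.
  have [kj|kj] := pselect (target k = target j); first by right.
  exfalso; apply: kj; apply: term_almost_disjoint => N.
  have [n Nn] := kF N; case=> [/FA[[m _ mn] _]|nj].
    by exists n => //; exists m.
  (* If term [n] is the added limit point, a later visit must be to [F], since [term k] is
     injective. *)
  have [n' nn'] := kF n.+1; case=> [/FA[[m _ mn] _]|nj'].
    by exists n'; [exact: leq_trans Nn (ltnW nn')|exists m].
  suff en : n' = n by rewrite en ltnn in nn'.
  by apply: (@term_inj k); rewrite nj nj'.
Qed.

(** Choosing at each node a child in [U] traces a branch that stays in [U] after its first node; it
    converges to [w], so it enters [V]. *)
Lemma pt_open_meet (U V : set pt) z w : open U -> open V -> U z -> V w ->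
  U `&` V !=set0.
Proof.
rewrite !pt_openE => oU oV Uz Vw.
have /choice[g gU] s : exists n, U (node z w (rcons s n)).
  by have [N UN] := oU (Children z w s) Uz; exists N; exact: UN.
pose t n := iter n (fun s => rcons s (g s)) [::].
have tE n : mkseq (g \o t) n = t n.
  by elim: n => // n IHn; rewrite mkseqS IHn.
have [N VN] := oV (Branch z w (g \o t)) Vw.
(* The index is [N.+1] because [t 0] is not a chosen child. *)
exists (node z w (t N.+1)); split; first exact: gU.
by have := VN N.+1 (leqnSn N); rewrite /= tE.
Qed.

Lemma pt_irreducible : irreducible [set: pt].
Proof.
split=> [|F G cF cG FG]; first by exists root.
have [[z Fz]|F0] := pselect ((~` F) !=set0); last first.
  by left=> x _; apply: contrapT => nFx; apply: F0; exists x.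
right=> w _; apply: contrapT => nGw.
have [||x [nFx nGx]] := @pt_open_meet (~` F) (~` G) z w _ _ Fz nGw.
- by rewrite openC.
- by rewrite openC.
- by have [] := FG x I.
Qed.

Theorem corollary5p3 :
  exists (d : Order.disp_t) (B : ctbDistrLatticeType d),
    [/\ complete_lattice B,
        well_filtered (scott B),
        ~ sober (scott B) &
        ~ co_sober (scott B)].
Proof.
have nomax y : exists z, ~~ (gmem pt_T1 z <= gmem pt_T1 y)%O.
  have [->|ny] := pselect (y = root); last first.
    by exists root; exact: gmem_antichain.
  by exists (node root root [::]); exact: gmem_antichain.
have cont := @gmem_continuous _ pt_T1 pt_seq.
have Kc := @compl_gmem_compact _ pt_T1 pt_seq (ex_intro _ _ pt_code_inj).
exists cond_display, (regset (cond pt)); split.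
- exact: regset_complete.
- exact/complete_lattice_well_filtered/regset_complete.
- exact: not_sober_of_continuous cont pt_irreducible nomax Kc.
- exact: not_co_sober_of_continuous cont pt_irreducible nomax Kc.
Qed.
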